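(* Let $a,b,c,d\in\mathbb{C}$ be such that $ad-bc\neq0$. Then for every integer $k\ge 1$ \begin{multline*} F_{k}=\frac{1}{(ad-bc)^{k-1}}\sum_{s=0}^{\lfloor\frac{k-1}{2}\rfloor}\sum_{m=0}^{k-2s-1}\binom{k-s-m-1}{s}\binom{m+s}{m}\cdot\\ (ad+bd-ac)^{k-2s-m-1}(a^2-b^2-ab)^s(d^2-c^2+cd)^s(ac-bc-bd)^m. \end{multline*}
   Context: $\{F_k\}_{k\ge 0}$ is the Fibonacci sequence: $F_0=0$, $F_1=1$, $F_{k+1}=F_k+F_{k-1}$ for $k\ge 1$. Convention: $x^0=1$ for every $x$, including $x=0$. *)

(* Defs.v *)
From mathcomp Require Import all_boot.

Set Implicit Arguments.
Unset Strict Implicit.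
Unset Printing Implicit Defensive.

Fixpoint fib (k : nat) : nat :=
  match k with
  | 0 => 0
  | 1 => 1
  | (k''.+1 as k').+1 => fib k' + fib k''
  end.

(* Main.v *)
Require Import Defs.
From mathcomp Require Import all_boot all_algebra reals.
From mathcomp Require Import complex.
From mathcomp Require Import zify ring.

Import GRing.Theory.
Local Open Scope ring_scope.
Local Open Scope complex_scope.

(** Put [A = ad + bd - ac], [M = ac - bc - bd], [D = ad - bc],
    [P = (a^2 - b^2 - ab)(d^2 - c^2 + cd)] and [n = k - 1].  The double sum is
    the coefficient of [x^n] in
      [\sum_s P^s x^(2s) / ((1 - A x)^(s+1) (1 - M x)^(s+1))],
    because [(1 - A x)^-(s+1)] has coefficients ['C(i + s, i) A^i].  This
    geometric series sums to [1 / ((1 - A x)(1 - M x) - P x^2)].  Since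
    [A + M = D] and [P - A M = D^2], it is [1 / (1 - D x - D^2 x^2)], the
    generating function of [D^n F_(n+1)].

    Power series are handled as their coefficient sequences [nat -> S]: [lag]
    is multiplication by a power of [x], [conv] is the product, and [negbin]
    is a negative power of [1 - A x].  The heart is [conv_negbinS]: multiplying
    by [(1 - A x)(1 - M x)] lowers the exponent [s + 1] to [s].  Summed over
    [s], it gives the second-order recurrence [negbin_sum_rec], which is the
    Fibonacci recurrence up to powers of [D]. *)

Section CoefficientSequences.

Variable S : comPzRingType.
Implicit Types (f g : nat -> S) (A M P D : S).

(** The coefficients of [x^j f(x)]. *)
Definition lag j f n : S := if (j <= n)%N then f (n - j)%N else 0.

Definition conv f g n : S := \sum_(i < n.+1) f i * g (n - i)%N.

(** The coefficients of [(1 - A x)^-s].  The truncated predecessor makes the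
    case [s = 0] correct: ['C(i.-1, i)] is [1] for [i = 0] and [0] otherwise. *)
Definition negbin A s i : S := 'C((i + s).-1, i)%:R * A ^+ i.

Lemma lag_lag j l f n : lag j (lag l f) n = lag (j + l) f n.
Proof.
rewrite /lag; case: (leqP j n) => hj; last by rewrite ifF //; lia.
have -> : (l <= n - j)%N = (j + l <= n)%N by lia.
by rewrite subnDA.
Qed.

Lemma conv_lag1l f g n : conv (lag 1 f) g n = lag 1 (conv f g) n.
Proof.
rewrite /conv big_ord_recl {1}/lag mul0r add0r.
case: n => [|n]; first by rewrite big_ord0.
rewrite /lag /= subn1; apply: eq_bigr => i _.
by rewrite /bump add1n subn1 subSS.
Qed.

Lemma convC f g n : conv f g n = conv g f n.
Proof.
rewrite /conv (reindex_inj rev_ord_inj); apply: eq_bigr => i _ /=.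
by rewrite mulrC subSS subKn // -ltnS.
Qed.

Lemma conv_lag1r f g n : conv f (lag 1 g) n = lag 1 (conv f g) n.
Proof. by rewrite convC conv_lag1l /lag convC. Qed.

Lemma conv_lag1lr f g n : conv (lag 1 f) (lag 1 g) n = lag 2 (conv f g) n.
Proof. by rewrite conv_lag1l -(lag_lag 1 1) /lag conv_lag1r. Qed.

(** [(1 - A x) * (1 - A x)^-(s+1) = (1 - A x)^-s], which on coefficients is
    Pascal's rule. *)
Lemma negbinS A s n :
  negbin A s n = negbin A s.+1 n - A * lag 1 (negbin A s.+1) n.
Proof.
rewrite /negbin /lag; case: n => [|n] /=; first by rewrite !bin0 mulr0 subr0.
rewrite subn1 /= !addnS /= binS natrD exprS; ring.
Qed.

(** Multiplication by [x] in either factor is multiplication by [x] of the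
    product, so the two identities [negbinS] for [M] and [A] multiply to
    [(1 - M x)(1 - A x) = 1 - (A + M) x + A M x^2]. *)
Lemma conv_negbinS M A s n :
  conv (negbin M s) (negbin A s) n =
  conv (negbin M s.+1) (negbin A s.+1) n
  - (A + M) * lag 1 (conv (negbin M s.+1) (negbin A s.+1)) n
  + A * M * lag 2 (conv (negbin M s.+1) (negbin A s.+1)) n.
Proof.
rewrite -conv_lag1lr mulrDl -{1}conv_lag1r -conv_lag1l /conv.
rewrite !mulr_sumr -big_split /= -sumrB -big_split /=.
by apply: eq_bigr => i _; rewrite !(negbinS _ s); ring.
Qed.

Lemma conv_negbin0 M A n : conv (negbin M 0) (negbin A 0) n.+1 = 0.
Proof.
rewrite /conv big1 // => -[[|i] hi] _; rewrite /negbin /= addn0.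
  by rewrite subn0 [X in _ * X](_ : _ = 0) ?mulr0 // bin_small ?mul0r //; lia.
by rewrite [X in X * _](_ : _ = 0) ?mul0r // bin_small ?mul0r.
Qed.

(** The coefficients of
    [\sum_s P^s x^(2s) (1 - M x)^-(s+1) (1 - A x)^-(s+1)]. *)
Definition negbin_sum M A P n : S :=
  \sum_(0 <= s < (n %/ 2).+1)
    P ^+ s * conv (negbin M s.+1) (negbin A s.+1) (n - 2 * s)%N.

(** Allows the sums for [n], [n + 1] and [n + 2] to be put on a common range
    of [s]. *)
Lemma negbin_sum_widen M A P n N : (n %/ 2 < N)%N ->
  negbin_sum M A P n =
  \sum_(0 <= s < N)
    P ^+ s * lag (2 * s) (conv (negbin M s.+1) (negbin A s.+1)) n.
Proof.
move=> hN; rewrite (@big_cat_nat _ _ _ (n %/ 2).+1) //= [X in _ + X]big_nat.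
rewrite [X in _ + X]big1 => [|s hs].
  rewrite addr0; apply: eq_big_nat => s hs; rewrite /lag ifT //; lia.
rewrite /lag ifF ?mulr0 //; lia.
Qed.

(** The coefficient of [x^(n+2)] in
    [(1 - (A + M) x + A M x^2) G = 1 + P x^2 G], where [G] is the series with
    coefficients [negbin_sum M A P]. *)
Lemma negbin_sum_rec M A P n :
  negbin_sum M A P n.+2 =
  (A + M) * negbin_sum M A P n.+1 + (P - A * M) * negbin_sum M A P n.
Proof.
have hN : (n.+2 %/ 2 < n.+3)%N by lia.
have hN1 : (n.+1 %/ 2 < n.+3)%N by lia.
have hN0 : (n %/ 2 < n.+3)%N by lia.
pose h s := conv (negbin M s) (negbin A s).
(* Replacing the exponents [s + 1] by [s] turns [G] into [1 + P x^2 G], and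
   the constant [1] does not reach degree [n + 2]. *)
have step : \sum_(0 <= s < n.+3) P ^+ s * lag (2 * s) (h s) n.+2 =
            P * negbin_sum M A P n.
  rewrite big_nat_recl // /lag muln0 subn0 /= [h _ _]conv_negbin0 mulr0 add0r.
  rewrite (@negbin_sum_widen _ _ _ _ n.+2); last by lia.
  rewrite mulr_sumr; apply: eq_bigr => s _; rewrite /lag exprS mulrA.
  have -> : (2 * s.+1 <= n.+2)%N = (2 * s <= n)%N by lia.
  by have -> : (n.+2 - 2 * s.+1 = n - 2 * s)%N by lia.
rewrite mulrBl -step (negbin_sum_widen _ _ _ _ _ hN).
rewrite (negbin_sum_widen _ _ _ _ _ hN1) (negbin_sum_widen _ _ _ _ _ hN0).
rewrite !mulr_sumr -sumrB -big_split /=; apply: eq_bigr => s _.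
have shift1 : lag (2 * s) (lag 1 (h s.+1)) n.+2 = lag (2 * s) (h s.+1) n.+1.
  by rewrite lag_lag addnC -lag_lag {1}/lag subn1.
have shift2 : lag (2 * s) (lag 2 (h s.+1)) n.+2 = lag (2 * s) (h s.+1) n.
  by rewrite lag_lag addnC -lag_lag {1}/lag subn2.
rewrite -/(h s.+1) -shift1 -shift2 /lag.
case: ifP => _; last by ring.
rewrite [h s _]conv_negbinS -/(h s.+1) /lag; ring.
Qed.

Lemma negbin_sum_fib M A P D n : A + M = D -> P - A * M = D ^+ 2 ->
  negbin_sum M A P n = D ^+ n * (fib n.+1)%:R.
Proof.
move=> hD hP.
suff: negbin_sum M A P n = D ^+ n * (fib n.+1)%:R /\
      negbin_sum M A P n.+1 = D ^+ n.+1 * (fib n.+2)%:R by case.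
elim: n => [|n [IH0 IH1]].
  rewrite /negbin_sum /conv /negbin !big_nat1 !big_ord_recl !big_ord0 -hD /=.
  rewrite !bin1 !bin0 /bump /= !muln0 !subn0 ?subnn !addn0 !add0n.
  by rewrite !expr0 !expr1; split; ring.
split=> //; rewrite negbin_sum_rec hD hP IH0 IH1.
have -> : fib n.+3 = (fib n.+2 + fib n.+1)%N by [].
by move: (fib n.+2) (fib n.+1) => u v; rewrite natrD !exprS; ring.
Qed.

End CoefficientSequences.

Theorem corollary4p6 (R : realType) (a b c d : R[i])
    (hD : a * d - b * c != 0) (k : nat) (hk : (1 <= k)%N) :
  (fib k)%:R =
    1 / (a * d - b * c) ^+ (k - 1) *
    \sum_(0 <= s < ((k - 1) %/ 2).+1)
      \sum_(0 <= m < (k - 2 * s - 1).+1)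
        'C(k - s - m - 1, s)%:R * 'C(m + s, m)%:R *
        (a * d + b * d - a * c) ^+ (k - 2 * s - m - 1) *
        (a ^+ 2 - b ^+ 2 - a * b) ^+ s *
        (d ^+ 2 - c ^+ 2 + c * d) ^+ s *
        (a * c - b * c - b * d) ^+ m.
Proof.
case: k hk => // n _; rewrite subn1 /=.
set A := a * d + b * d - a * c; set M := a * c - b * c - b * d.
set P1 := a ^+ 2 - _ - _; set P2 := d ^+ 2 - _ + _.
have hAM : A + M = a * d - b * c by rewrite /A /M; ring.
have hP : P1 * P2 - A * M = (a * d - b * c) ^+ 2.
  by rewrite /P1 /P2 /A /M; ring.
have := negbin_sum_fib _ _ _ _ _ n hAM hP; rewrite /negbin_sum => hsum.
rewrite [X in _ * X](_ : _ = (a * d - b * c) ^+ n * (fib n.+1)%:R).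
  by rewrite mulrA div1r mulVf ?mul1r // expf_neq0.
rewrite -hsum; apply: eq_big_nat => s hs.
rewrite /conv mulr_sumr big_mkord.
have -> : (n.+1 - 2 * s - 1 = n - 2 * s)%N by lia.
apply: eq_bigr => m _; have hm := ltn_ord m; rewrite /negbin addnS /=.
have -> : (n.+1 - 2 * s - m - 1 = n - 2 * s - m)%N by lia.
have -> : (n.+1 - s - m - 1 = n - 2 * s - m + s)%N by lia.
rewrite addnS /= -(bin_sub (leq_addl _ s)) addnK exprMn; ring.
Qed.
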